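(* Let $(d(t),\,t\ge0)$ be a nonnegative, locally integrable demand function, let $(E_i(0),\,i\in\mathcal S)$ be a given initial energy configuration with $0\le E_i(0)\le\overline E_i$, and let $T\in(0,\infty]$. Among all discharge-only policies, the unserved energy demand $\int_0^T\max\bigl(d(t)-\sum_{i\in\mathcal S}r_i(t),0\bigr)\,dt$ is minimised by the GGDDF policy, and its minimum value is $$\max_{p\ge0}\bigl(e_D^{0,T}(p)-e_S^{0}(p)\bigr).$$
   Context: A finite set $\mathcal S$ of energy stores is given. Store $i\in\mathcal S$ has capacity $\overline E_i>0$ and maximum discharge rate $P_i>0$. A (discharge-only) policy is a choice of measurable rate functions $(r_i(t),\,t\ge0)$, $i\in\mathcal S$, with stored energies $E_i(t)=E_i(0)-\int_0^t r_i(u)\,du$, subject to $0\le E_i(t)\le\overline E_i$, $0\le r_i(t)\le P_i$ and $\sum_{i\in\mathcal S}r_i(t)\le d(t)$ for all $t\ge0$, where $(d(t),\,t\ge0)$ is a nonnegative demand function. The unserved energy over $[0,T]$ is $\int_0^T\max\bigl(d(t)-\sum_{i}r_i(t),0\bigr)dt$. Burst-power profile at time $t$: $s^t(u)=\sum_{i\in\mathcal S:\,E_i(t)/P_i\ge u}P_i$ for $u\ge 0$ (the quantity $E_i(t)/P_i$ is the discharge-duration of store $i$). Energy-power transform of the stores at time $t$: $e_S^t(p)=\int_0^\infty\max(0,s^t(u)-p)\,du$, $p\ge0$. Energy-power transform of the demand on $[t,T]$: $e_D^{t,T}(p)=\int_t^T\max(0,d(u)-p)\,du$, $p\ge0$ (with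 $T=\infty$ allowed). GGDDF (greedy greatest-discharge-duration-first) policy: at (almost) every time $t$, the total served rate is $\bar d(t)=\min\bigl(d(t),\sum_{i:E_i(t)>0}P_i\bigr)$, and it is allocated as follows: the nonempty stores are partitioned into groups $G_1,G_2,\dots$ of equal discharge-duration $E_i(t)/P_i$, listed in strictly decreasing order of that duration; letting $m$ be the least index with $\sum_{k\le m}\sum_{i\in G_k}P_i\ge\bar d(t)$, every store in $G_k$ with $k<m$ discharges at rate $P_i$, every store $i\in G_m$ discharges at rate $\lambda P_i$ with $\lambda\in(0,1]$ chosen so that $\sum_i r_i(t)=\bar d(t)$, and all other stores have rate $0$ (all rates are $0$ if $\bar d(t)=0$). *)

(* Defs.v *)
From HB Require Import structures.
From mathcomp Require Import all_boot all_order all_algebra.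
From mathcomp Require Import all_classical all_reals all_analysis.
Set Implicit Arguments. Unset Strict Implicit. Unset Printing Implicit Defensive.
Import Order.TTheory GRing.Theory Num.Theory.
Import numFieldNormedType.Exports.
Local Open Scope classical_set_scope.
Local Open Scope ring_scope.

Section Defs.
Variables (R : realType) (S : finType).
Notation mu := (@lebesgue_measure R).

Definition energy (E0 : S -> R) (r : S -> R -> R) (i : S) (t : R) : R :=
  E0 i - Rintegral mu `[0, t] (r i).

Definition is_policy (Ebar P : S -> R) (d : R -> R) (E0 : S -> R)
  (r : S -> R -> R) : Prop :=
  (forall i, measurable_fun [set t : R | 0 <= t] (r i)) /\
  (forall t, 0 <= t ->
     (forall i, 0 <= energy E0 r i t <= Ebar i) /\
     (forall i, 0 <= r i t <= P i) /\
     \sum_(i : S) r i t <= d t).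

Definition upto (T : \bar R) : set R := [set t | (0 <= t)%R /\ (t%:E <= T)%E].

Definition unserved (d : R -> R) (r : S -> R -> R) (T : \bar R) : \bar R :=
  (\int[mu]_(t in upto T) (Num.max (d t - \sum_(i : S) r i t) 0)%R%:E)%E.

Definition burst (P : S -> R) (E : S -> R) (u : R) : R :=
  \sum_(i : S | u <= E i / P i) P i.

Definition eS (P : S -> R) (E : S -> R) (p : R) : \bar R :=
  (\int[mu]_(u in [set u : R | (0 <= u)%R]) (Num.max 0 (burst P E u - p)%R)%:E)%E.

Definition eD (d : R -> R) (T : \bar R) (p : R) : \bar R :=
  (\int[mu]_(u in upto T) (Num.max 0 (d u - p)%R)%:E)%E.

(* GGDDF allocation rule at time t, given energies E, demand dt, rates rt.
   Groups of equal discharge duration are described by a threshold duration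
   delta (the duration of the group G_m) : groups before G_m are exactly the
   nonempty stores of duration > delta. *)
Definition ggddf_at (P : S -> R) (E : S -> R) (dt : R) (rt : S -> R) : Prop :=
  let dbar := Num.min dt (\sum_(i : S | 0 < E i) P i) in
  \sum_(i : S) rt i = dbar /\
  ((dbar = 0 /\ forall i, rt i = 0) \/
   (0 < dbar /\
    exists (delta lambda : R),
      (0 < lambda <= 1) /\
      (exists i, 0 < E i /\ E i / P i = delta) /\
      \sum_(i : S | (0 < E i) && (delta < E i / P i)) P i < dbar /\
      forall i,
        rt i = (if (0 < E i) && (delta < E i / P i) then P i
                else if (0 < E i) && (E i / P i == delta) then lambda * P i
                else 0))).

Definition ggddf (Ebar P : S -> R) (d : R -> R) (E0 : S -> R)
  (r : S -> R -> R) : Prop :=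
  is_policy Ebar P d E0 r /\
  {ae mu, forall t : R, 0 <= t ->
     ggddf_at P (fun i => energy E0 r i t) (d t) (fun i => r i t)}.

End Defs.

(* Main.v *)
Require Import Defs.
From HB Require Import structures.
From mathcomp Require Import all_boot all_order all_algebra.
From mathcomp Require Import all_classical all_reals all_analysis.
From mathcomp Require Import measurable_realfun.
From mathcomp Require Import ring lra.
Import Order.TTheory GRing.Theory Num.Theory.
Import numFieldNormedType.Exports.
Local Open Scope classical_set_scope.
Local Open Scope ring_scope.
Set Implicit Arguments.
Unset Strict Implicit.
Unset Printing Implicit Defensive.

(* Let [fill x p i] be the power that store [i] contributes to the top [p] units of power when the stores are stacked by decreasing duration [x]; the GGDDF rates are [fill] at height [d t] on the nonempty stores. Since [eS p] equals [\sum_i w_i E_i] with [w_i = 1 - fill x p i / P i], and [(d - p)^+ <= (d - \sum_i r_i)^+ + \sum_i w_i r_i] for admissible rates, every policy satisfies [eD p - eS p <= unserved].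
   Under GGDDF the order of the durations is never reversed. Taking for [p] the total power of the set [K] of stores whose energy stays bounded away from 0, the stores of [K] always have priority and the other ones end up empty, so that [(d - p)^+ = (d - \sum_i r_i)^+ + \sum_(i notin K) r_i] almost everywhere, which integrates to equality.
   For existence, run the rates prescribed by the initial order until two durations meet or a store empties; this can happen only finitely often because each such event coarsens the order. *)

(** * Stacking powers by decreasing duration *)

Section Fill.
Variables (R : realFieldType) (S : finType) (P : S -> R).
Hypothesis P_gt0 : forall i, 0 < P i.
Implicit Types (x : S -> R) (y : R) (i j : S).

Definition above x i : R := \sum_(j | x i < x j) P j.
Definition tied x i : R := \sum_(j | x j == x i) P j.

(** The tier tied with [i] occupies the heights from [above x i] to [above x i + tied x i]. The
    difference of minima is the part of that tier below height [y], shared in proportion to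
    power. *)
Definition fill x y i : R :=
  P i / tied x i *
    (Num.min y (above x i + tied x i) - Num.min y (above x i)).

Lemma sum_P_ge0 (Q : pred S) : 0 <= \sum_(i | Q i) P i.
Proof. by apply: sumr_ge0 => i _; exact: ltW. Qed.

Lemma tied_gt0 x i : 0 < tied x i.
Proof.
by rewrite /tied (bigD1 i)//= ltr_pwDl// sum_P_ge0.
Qed.

Lemma fill_ge0 x y i : 0 <= fill x y i.
Proof.
apply: mulr_ge0; first by rewrite divr_ge0 ?ltW ?tied_gt0.
have := tied_gt0 x i; case: (leP y (above x i)) => ?; case: (leP y (_ + _)) => ?; lra.
Qed.

Lemma fill_le x y i : fill x y i <= P i.
Proof.
rewrite /fill mulrAC ler_pdivrMr ?tied_gt0// ler_pM2l//.
have := tied_gt0 x i; case: (leP y (above x i)) => ?; case: (leP y (_ + _)) => ?; lra.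
Qed.

Lemma fill_eq x x' y i :
  (forall j, (x i < x j) = (x' i < x' j)) ->
  (forall j, (x j == x i) = (x' j == x' i)) -> fill x y i = fill x' y i.
Proof.
move=> xlt xeq; rewrite /fill.
have -> : above x i = above x' i by exact: eq_bigl.
by have -> : tied x i = tied x' i by exact: eq_bigl.
Qed.

(** Removing the tier of least duration from [Q] leaves an up-closed set of total power
    [above x i0]. The contribution of the removed tier telescopes with the induction hypothesis. *)
Lemma sum_fill x y (Q : pred S) : 0 <= y ->
  (forall i j, Q i -> x i <= x j -> Q j) ->
  \sum_(i | Q i) fill x y i = Num.min y (\sum_(i | Q i) P i).
Proof.
move=> y_ge0.
have [n] := ubnP #|Q|; elim: n Q => // n IHn Q; rewrite ltnS => leQn upQ.
have [i0 Qi0|Q0] := pickP Q; last by rewrite !big_pred0// min_r.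
case: (arg_minP x Qi0) => {i0 Qi0}i0 Qi0 min_i0.
have QE i : Q i = (x i0 <= x i).
  by apply/idP/idP => [/min_i0//|]; exact: upQ.
have split_Q (F : S -> R) :
    \sum_(i | Q i) F i = \sum_(i | x i0 < x i) F i + \sum_(i | x i == x i0) F i.
  rewrite (bigID (fun i => x i0 < x i))/=; congr (_ + _); apply: eq_bigl => i.
    by rewrite QE andb_idl// => /ltW.
  by rewrite QE -leNgt -eq_le eq_sym.
rewrite !split_Q IHn; last 2 first.
- apply: leq_trans leQn; apply: proper_card; apply/properP; split.
    by apply/fintype.subsetP => i; rewrite !unfold_in QE; exact: ltW.
  by exists i0; rewrite // unfold_in ltxx.
- by move=> i j; exact: lt_le_trans.
have -> : \sum_(i | x i == x i0) fill x y i =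
    Num.min y (above x i0 + tied x i0) - Num.min y (above x i0).
  rewrite (eq_bigr (fun i => P i * ((tied x i0)^-1 *
      (Num.min y (above x i0 + tied x i0) - Num.min y (above x i0))))).
    by rewrite -mulr_suml -/(tied x i0) mulrA divff ?mul1r// gt_eqF ?tied_gt0.
  by move=> i /eqP xi; rewrite /fill /above /tied xi mulrA.
by rewrite -/(above x i0) -/(tied x i0) addrC subrK.
Qed.

Lemma fill_full x y i : above x i + tied x i <= y -> fill x y i = P i.
Proof.
move=> ley; have t_gt0 := tied_gt0 x i.
rewrite /fill !min_r//; last by rewrite (le_trans _ ley)// lerDl ltW.
by rewrite [above _ _ + _]addrC addrK divfK// gt_eqF.
Qed.

Lemma fill_gt0 x y i : 0 < fill x y i -> above x i < y.
Proof.
rewrite [_ < y]ltNge; apply: contraTN => ley; rewrite -leNgt; have t_gt0 := tied_gt0 x i.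
by rewrite /fill !min_l ?subrr ?mulr0// (le_trans ley)// lerDl ltW.
Qed.

Lemma above_tied_le x i j : x j < x i -> above x i + tied x i <= above x j.
Proof.
move=> ji.
rewrite {2}/above (bigID (fun k => x i < x k))/= lerD//.
  by rewrite (eq_bigl (fun k => x i < x k))// => k; rewrite andb_idl// => /(lt_trans ji).
rewrite /tied [leRHS](bigID (fun k => x k == x i))/=.
rewrite [X in _ <= X + _](eq_bigl (fun k => x k == x i)) ?lerDl ?sum_P_ge0// => k.
by have [->|] := eqVneq (x k) (x i); rewrite ?ji ?ltxx ?andbF.
Qed.

(** The tier of [j] starts below [y], and the tier of [i] ends no higher than that start. *)
Lemma fill_priority x y i j : x j < x i -> 0 < fill x y j -> fill x y i = P i.
Proof.
by move=> ji /fill_gt0 ltjy; apply: fill_full; rewrite ltW// (le_lt_trans _ ltjy)// above_tied_le.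
Qed.

Lemma fill_tied x y i j : x i = x j -> fill x y i / P i = fill x y j / P j.
Proof.
have cancelP k t m : P k / t * m / P k = t^-1 * m.
  by rewrite mulrAC [_ / _ / _]mulrAC divff ?gt_eqF// mul1r.
by move=> xij; rewrite /fill !cancelP /above /tied xij.
Qed.

Lemma fill_ratio_le x y i j : x j <= x i -> fill x y j / P j <= fill x y i / P i.
Proof.
rewrite le_eqVlt => /predU1P[/(fill_tied y)->//|ji].
have [f0|] := leP (fill x y j) 0.
  by rewrite (@le_trans _ _ 0) ?divr_ge0 ?fill_ge0 ?(ltW (P_gt0 _))// pmulr_lle0 ?invr_gt0.
move=> /(fill_priority ji)->; rewrite divff ?gt_eqF// ler_pdivrMr ?mul1r//.
exact: fill_le.
Qed.

End Fill.

(** * The GGDDF allocation rule at one instant *)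

Section GgddfAt.
Variables (R : realType) (S : finType) (P : S -> R).
Hypothesis P_gt0 : forall i, 0 < P i.
Implicit Types (E r : S -> R) (y : R).

Lemma ggddf_at_priority E y r i j : ggddf_at P E y r ->
  E j / P j < E i / P i -> 0 < r j -> r i = P i.
Proof.
move=> [_ [[_ r0]|[_ [delta [lambda [_ [[k [Ek xk]] [_ rE]]]]]]]] ji.
  by rewrite r0 ltxx.
(* Positivity of the threshold gives [0 < E i] below, which the rule requires before it grants full
   power. *)
have delta_gt0 : 0 < delta by rewrite -xk divr_gt0.
rewrite (rE j) (rE i) => rj.
have delta_j : delta <= E j / P j.
  move: rj; case: ifP => [/andP[_ /ltW]//|_].
  by case: ifP => [/andP[_ /eqP->]//|_]; rewrite ltxx.
have delta_i := le_lt_trans delta_j ji.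
rewrite delta_i andbT ifT// -(pmulr_lgt0 _ (_ : 0 < (P i)^-1)) ?invr_gt0//.
exact: lt_trans delta_i.
Qed.

(** The fraction of full power in use is either identically 0 or a step function of the duration
    with values 0, [lambda], 1. In both cases it is nondecreasing, so longer durations shrink at
    least as fast as shorter ones. *)
Lemma ggddf_at_ratio_le E y r i j : ggddf_at P E y r ->
  E j / P j <= E i / P i -> r j / P j <= r i / P i.
Proof.
move=> [_ [[_ r0] _|[_ [delta [lambda [lambda01 [_ [_ rE]]]]]] ji]].
  by rewrite !r0 !mul0r.
have gt0E k : (0 < E k) = (0 < E k / P k) by rewrite pmulr_lgt0 ?invr_gt0.
have ratioE k : r k / P k = if (0 < E k / P k) && (delta < E k / P k) then 1
    else if (0 < E k / P k) && (E k / P k == delta) then lambda else 0.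
  rewrite rE gt0E; case: ifP => _; first by rewrite divff ?gt_eqF.
  by case: ifP => _; rewrite ?mul0r// mulfK ?gt_eqF.
rewrite !ratioE; move: ji lambda01; move: (E i / P i) (E j / P j) => a b.
case: (ltP 0 a) => a0; case: (ltP 0 b) => b0 ba /andP[l0 l1] //=; last 2 first.
- by case: ifP => _ //; case: ifP => _ //; lra.
- lra.
- case: (ltgtP delta b); case: (ltgtP delta a); lra.
Qed.

(** The stack also contains the empty stores, but the nonempty ones form an up-closed set, so
    [sum_fill] gives the total served rate after the empty stores are set to 0. *)
Lemma ggddf_at_fill E y : 0 <= y ->
  ggddf_at P E y
    (fun i => if 0 < E i then fill P (fun j => E j / P j) y i else 0).
Proof.
move=> y_ge0; set x := fun j => E j / P j; rewrite /ggddf_at.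
have gt0E k : (0 < E k) = (0 < x k) by rewrite /x pmulr_lgt0 ?invr_gt0.
have sumE : \sum_i (if 0 < E i then fill P x y i else 0) =
    Num.min y (\sum_(i | 0 < E i) P i).
  rewrite -big_mkcond/= sum_fill// => i j; rewrite !gt0E; exact: lt_le_trans.
split=> //.
set dbar := Num.min _ _ in sumE *.
have dbar_ge0 : 0 <= dbar by rewrite le_min y_ge0 sum_P_ge0.
move: (dbar_ge0); rewrite le_eqVlt => /predU1P[dbar0|dbar_gt0].
  left; split=> // i; move: sumE; rewrite -dbar0 => /eqP.
  rewrite psumr_eq0 => [/allP/(_ i)|k _]; first by rewrite mem_index_enum => /(_ isT)/eqP.
  by case: ifP => // _; exact: fill_ge0.
right; split=> //.
have [i0 /andP[Ei0 ri0]|none] := pickP [pred i | (0 < E i) && (0 < fill P x y i)]; last first.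
  move: dbar_gt0; rewrite -sumE big1 ?ltxx// => i _.
  case: ifP => // Ei; apply/eqP; rewrite eq_le fill_ge0// andbT leNgt.
  by have := none i; rewrite /= Ei /= => ->.
(* The threshold group is that of the shortest nonempty store [k] still discharging, and [lambda] is
   the fraction of its power in use. *)
have := @arg_minP _ _ _ i0 [pred i | (0 < E i) && (0 < fill P x y i)] x.
rewrite /= Ei0 ri0 => /(_ isT)[{Ei0 ri0}k /andP[Ek rk] min_k].
exists (x k), (fill P x y k / P k); split; first by rewrite divr_gt0// ler_pdivrMr// mul1r fill_le.
split; first by exists k.
split.
  rewrite (eq_bigl (fun j => x k < x j)); last first.
    by move=> j; rewrite gt0E andb_idl// => /(lt_trans _)->//; rewrite -gt0E.
  (* The power above [k] is less than [y] because [k] discharges, and less than the total nonempty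
     power because [k] itself adds to the latter. *)
  rewrite -/(above P x k) lt_min (fill_gt0 P_gt0 rk)/= [ltRHS](bigID (fun j => x k < x j))/=.
  rewrite (eq_bigl (fun j => x k < x j)).
    by rewrite ltrDl (bigD1 k) ?Ek ?ltxx//= ltr_pwDl// sum_P_ge0.
  by move=> j; rewrite gt0E andb_idl// => /(lt_trans _)->//; rewrite -gt0E.
move=> i; rewrite -/(x i); case: ifPn => //= Ei.
case: ifP => [ki|ik]; first exact: fill_priority rk.
case: eqP => [xik|/eqP xik].
  by rewrite -(fill_tied P_gt0 y xik) divfK// gt_eqF.
apply/eqP; rewrite eq_le fill_ge0// andbT leNgt; apply/negP => fi.
have := min_k i; rewrite /= Ei fi => /(_ isT).
by rewrite le_eqVlt ik eq_sym (negbTE xik).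
Qed.

End GgddfAt.

(** Here [tau] is the infimum of the points of [[a, b]] where [g <= 0]. The Lipschitz bound excludes
    [g tau > 0], since [g] would stay positive shortly after [tau], and [g tau < 0], since [g] would
    already be negative shortly before. *)
Lemma first_exit (R : realType) (g : R -> R) (M a b : R) :
  (forall u v, a <= u -> u <= v -> v <= b -> `|g u - g v| <= M * (v - u)) ->
  0 <= M -> a <= b -> 0 < g a -> g b <= 0 ->
  exists tau, [/\ a <= tau <= b, g tau = 0 & forall t, a <= t < tau -> 0 < g t].
Proof.
move=> lip M_ge0 ab ga gb.
pose A := [set t : R | a <= t <= b /\ g t <= 0].
have Ab : A b by split=> //; rewrite ab lexx.
have lbA : lbound A a by move=> t [/andP[]].
have infA : has_inf A by split; [exists b|exists a].
have a_inf : a <= inf A by apply: lb_le_inf => //; exists b.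
have inf_b : inf A <= b by apply: ge_inf => //; exists a.
have before t : a <= t < inf A -> 0 < g t.
  move=> /andP[a_t t_inf]; rewrite ltNge; apply/negP => gt.
  have : inf A <= t.
    by apply: ge_inf; [exists a|split=> //; rewrite a_t (le_trans (ltW t_inf))].
  by rewrite leNgt t_inf.
(* Dividing by [M + 1] instead of [M] covers the case [M = 0]. *)
have M1 : 0 < M + 1 by lra.
exists (inf A); split=> //; first by rewrite a_inf.
apply/eqP; rewrite eq_le; apply/andP; split; rewrite leNgt; apply/negP => g_inf.
- have eps_gt0 : 0 < g (inf A) / (M + 1) by rewrite divr_gt0.
  have [t [/andP[a_t tb] gt]] := inf_adherent eps_gt0 infA.
  have inf_t : inf A <= t by apply: ge_inf; [exists a|split=> //; rewrite a_t].
  have := lip _ _ a_inf inf_t tb; rewrite -ltrBlDl ltr_pdivlMr// => /(le_trans (ler_norm _)).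
  nra.
- have a_lt : a < inf A.
    by rewrite lt_neqAle a_inf andbT; apply/eqP => aE; move: ga; rewrite aE; lra.
  pose t := Num.max a (inf A + g (inf A) / (M + 1)).
  have t_lt : t < inf A.
    by rewrite gt_max a_lt/= gtrDl pmulr_llt0 ?invr_gt0.
  have a_t : a <= t by rewrite le_max lexx.
  have gt : 0 < g t by apply: before; rewrite a_t.
  have : inf A + g (inf A) / (M + 1) <= t by rewrite le_max lexx orbT.
  rewrite -lerBrDl ler_pdivrMr//.
  have := lip _ _ a_t (ltW t_lt) inf_b => /(le_trans (ler_norm _)).
  nra.
Qed.

(** * Integrals of bounded measurable rates over time intervals *)

Section Rates.
Variable R : realType.
Notation mu := (@lebesgue_measure R).
Implicit Types (f g : R -> R) (M s t u : R) (T : \bar R).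

(** The bound makes a rate integrable on bounded intervals, so the real-valued integrals in [energy]
    are genuine and not a default value of [fine]. *)
Definition is_rate f M : Prop :=
  measurable_fun [set t : R | 0 <= t] f /\ forall t, 0 <= t -> 0 <= f t <= M.

Lemma ge0_setE : [set t : R | 0 <= t] = `[0, +oo[%classic.
Proof. by apply/seteqP; split=> t /=; rewrite in_itv/= andbT. Qed.

Lemma measurable_ge0_set : measurable [set t : R | 0 <= t].
Proof. by rewrite ge0_setE. Qed.

Lemma itv_sub_ge0 s t : 0 <= s -> `[s, t] `<=` [set u : R | 0 <= u].
Proof. by move=> s_ge0 u /=; rewrite in_itv/= => /andP[/(le_trans s_ge0)]. Qed.

Lemma itv_ge0 s t u : 0 <= s -> `[s, t]%classic u -> 0 <= u.
Proof. by move=> s_ge0 /(itv_sub_ge0 s_ge0). Qed.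

Lemma upto_sub_ge0 T : upto T `<=` [set t : R | 0 <= t].
Proof. by move=> t []. Qed.

Lemma upto_fin t : upto t%:E = `[0, t]%classic.
Proof.
by apply/seteqP; split=> u /=; rewrite in_itv/= /upto/= lee_fin => /andP.
Qed.

Lemma upto_pinfty : upto +oo%E = [set t : R | 0 <= t].
Proof. by apply/seteqP; split=> u /=; rewrite /upto/= leey => // -[]. Qed.

Lemma measurable_upto T : measurable (upto T : set R).
Proof.
case: T => [t||].
- by rewrite upto_fin.
- by rewrite upto_pinfty; exact: measurable_ge0_set.
- rewrite [X in measurable X](_ : _ = set0)//.
  by apply/seteqP; split=> // u []; rewrite leeNy_eq.
Qed.

Lemma measurable_rate f M D : is_rate f M -> measurable D ->
  D `<=` [set t : R | 0 <= t] -> measurable_fun D f.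
Proof.
by move=> [mf _] mD sub; apply: measurable_funS mf => //; exact: measurable_ge0_set.
Qed.

Lemma integrable_rate f M s t : is_rate f M -> 0 <= s ->
  mu.-integrable `[s, t] (EFin \o f).
Proof.
move=> rf s_ge0; apply: measurable_bounded_integrable => //.
- by rewrite /= lebesgue_measure_itv/=; case: ifP => _; rewrite ?ltry// -EFinB ltry.
- by apply: (measurable_rate rf) => //; exact: itv_sub_ge0.
- exists M; split; first exact: num_real.
  move=> K MK u /= ust; have /andP[f0 fM] := rf.2 u (itv_ge0 s_ge0 ust).
  by rewrite ger0_norm// (le_trans fM)// ltW.
Qed.

Lemma EFin_Rintegral_rate f M s t : is_rate f M -> 0 <= s ->
  (Rintegral mu `[s, t] f)%:E = (\int[mu]_(u in `[s, t]) (f u)%:E)%E.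
Proof.
move=> rf s_ge0; rewrite /Rintegral fineK//.
by apply: integrable_fin_num => //; exact: integrable_rate rf s_ge0.
Qed.

Lemma Rintegral_rate_split f M s t u : is_rate f M -> 0 <= s -> s <= t -> t <= u ->
  Rintegral mu `[s, u] f = Rintegral mu `[s, t] f + Rintegral mu `[t, u] f.
Proof.
move=> rf s_ge0 st tu.
have := @Rintegral_itvB R f (BLeft s) (BRight u) t (integrable_rate u rf s_ge0).
rewrite !bnd_simp => /(_ st tu) /eqP; rewrite subr_eq addrC => /eqP ->.
rewrite Rintegral_itv_obnd_cbnd//.
apply: integrableS (integrable_rate u rf (le_trans s_ge0 st)) => //.
by apply: subset_itvr; rewrite bnd_simp.
Qed.

Lemma Rintegral_rate_ge0 f M s t : is_rate f M -> 0 <= s ->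
  0 <= Rintegral mu `[s, t] f.
Proof.
move=> rf s_ge0; apply: Rintegral_ge0 => u ust.
by have /andP[] := rf.2 u (itv_ge0 s_ge0 ust).
Qed.

Lemma Rintegral_rate_le f M s t : is_rate f M -> 0 <= s -> s <= t ->
  Rintegral mu `[s, t] f <= M * (t - s).
Proof.
move=> rf s_ge0 st.
have M_ge0 : 0 <= M by have /andP[f0] := rf.2 0 (lexx _); exact: le_trans.
have rM : is_rate (cst M) M by split=> [|u _ /=]; [exact: measurable_cst|rewrite /= M_ge0 lexx].
have -> : M * (t - s) = Rintegral mu `[s, t] (cst M).
  rewrite Rintegral_cst//= lebesgue_measure_itv/= lte_fin.
  case: ltP => // ts; have -> : t = s by apply/eqP; rewrite eq_le ts.
  by rewrite subrr mulr0.
apply: le_Rintegral => //.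
- exact: integrable_rate rf s_ge0.
- exact: integrable_rate rM s_ge0.
- by move=> u ust; have /andP[] := rf.2 u (itv_ge0 s_ge0 ust).
Qed.

Lemma Rintegral_rate_point f s : Rintegral mu `[s, s] f = 0.
Proof. by rewrite set_itv1 Rintegral_set1. Qed.

Lemma Rintegral_rate_mulr f M c s t : is_rate f M -> 0 <= s ->
  Rintegral mu `[s, t] (fun u => f u * c) = Rintegral mu `[s, t] f * c.
Proof.
by move=> rf s_ge0; rewrite RintegralZr//; exact: integrable_rate rf s_ge0.
Qed.

Lemma is_rate_mulr f M c : 0 <= c -> is_rate f M -> is_rate (fun u => f u * c) (M * c).
Proof.
move=> c_ge0 [mf bf]; split; first by apply: measurable_funM => //; exact: measurable_cst.
by move=> t /bf /andP[f0 fM]; rewrite mulr_ge0//= ler_wpM2r.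
Qed.

Lemma ae_le_Rintegral_rate f g M N s t : is_rate f M -> is_rate g N -> 0 <= s ->
  {ae mu, forall u, `[s, t]%classic u -> f u <= g u} ->
  Rintegral mu `[s, t] f <= Rintegral mu `[s, t] g.
Proof.
move=> rf rg s_ge0 fg.
rewrite -lee_fin (EFin_Rintegral_rate _ rf)// (EFin_Rintegral_rate _ rg)//.
apply: ae_ge0_le_integral => //.
- by move=> u ust; rewrite lee_fin; have /andP[] := rf.2 u (itv_ge0 s_ge0 ust).
- by apply/measurable_EFinP; apply: (measurable_rate rf) => //; exact: itv_sub_ge0.
- by move=> u ust; rewrite lee_fin; have /andP[] := rg.2 u (itv_ge0 s_ge0 ust).
- by apply/measurable_EFinP; apply: (measurable_rate rg) => //; exact: itv_sub_ge0.
Qed.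

Lemma integral_upto_ge f M T t : is_rate f M -> upto T t ->
  ((Rintegral mu `[0%R, t] f)%:E <= \int[mu]_(u in upto T) (f u)%:E)%E.
Proof.
move=> rf [t_ge0 tT]; rewrite (EFin_Rintegral_rate _ rf)//.
apply: ge0_subset_integral => //.
- exact: measurable_upto.
- apply/measurable_EFinP; apply: (measurable_rate rf (measurable_upto T)).
  exact: upto_sub_ge0.
- by move=> u /upto_sub_ge0 u_ge0; rewrite lee_fin; have /andP[] := rf.2 u u_ge0.
- move=> u /=; rewrite in_itv/= => /andP[u_ge0 ut]; split=> //.
  by rewrite (le_trans _ tT)// lee_fin.
Qed.

(** For [T = +oo] the bound passes to the limit by monotone convergence along the intervals
    [[0, n]]. *)
Lemma integral_upto_le f M T (c : R) : is_rate f M -> (0 <= T)%E ->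
  (forall t, upto T t -> Rintegral mu `[0, t] f <= c) ->
  (\int[mu]_(u in upto T) (f u)%:E <= c%:E)%E.
Proof.
move=> rf T_ge0 le_c.
case: T T_ge0 le_c => [t||] // T_ge0 le_c.
  by rewrite upto_fin -(EFin_Rintegral_rate _ rf)// lee_fin le_c.
rewrite upto_pinfty ge0_setE itv_bndy_bigcup_BRight.
have cvg_int := @ge0_nondecreasing_set_cvg_integral _ (measurableTypeR R) R
  (fun n => `[(0 : R), 0 + n%:R]%classic) (EFin \o f) mu.
apply: (cvge_le _ (cvg_int _ _ _ _)).
- near=> n; rewrite -(EFin_Rintegral_rate _ rf)// lee_fin add0r le_c//.
  by split; rewrite ?leey.
- by move=> m n mn; rewrite subsetEset; apply: subset_itvl; rewrite bnd_simp lerD2l ler_nat.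
- by [].
- move=> n; apply/measurable_EFinP; apply: (measurable_rate rf) => //.
  exact: itv_sub_ge0.
- by move=> n u un; rewrite lee_fin; have /andP[] := rf.2 u (itv_ge0 (lexx _) un).
Unshelve. all: by end_near. Qed.

End Rates.

(** * Energy-power transforms and the lower bound for every policy *)

Section Duality.
Variables (R : realType) (S : finType) (P : S -> R).
Hypothesis P_gt0 : forall i, 0 < P i.
Notation mu := (@lebesgue_measure R).

Let duration (E : S -> R) i := E i / P i.

(** The stores of duration at least [u] form an up-closed set, so by [sum_fill] the excess of their
    power over [p] is the sum of their shares lying above height [p]. Each share counts for the
    levels [u] up to the duration of its store. *)
Lemma eS_fill (E : S -> R) p : (forall i, 0 <= E i) -> 0 <= p ->
  eS P E p =
  (\sum_i (P i - fill P (duration E) p i) * duration E i)%:E.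
Proof.
move=> E_ge0 p_ge0; set x := duration E.
have x_ge0 i : 0 <= x i by rewrite divr_ge0// ltW.
transitivity (\int[mu]_(u in [set u : R | (0 <= u)%R])
    \sum_i ((P i - fill P x p i)%:E * (\1_`[0%R, x i] u)%:E))%E.
  apply: eq_integral => u; rewrite inE/= => u_ge0.
  under eq_bigr do rewrite -EFinM.
  rewrite sumEFin; congr EFin.
  have up i j : u <= x i -> x i <= x j -> u <= x j by exact: le_trans.
  rewrite (eq_bigr (fun i => if u <= x i then P i - fill P x p i else 0)).
    rewrite -big_mkcond sumrB (sum_fill P_gt0 p_ge0 up).
    rewrite -[X in X - Num.min _ X]/(burst P E u).
    by case: (leP p (burst P E u)) => ?; [rewrite max_r//|rewrite max_l ?subrr//]; lra.
  move=> i _; rewrite indicE; case: ifPn => ux.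
    by rewrite mem_set ?mulr1//= in_itv/= u_ge0.
  by rewrite memNset ?mulr0//= in_itv/= (negbTE ux) andbF.
have mD := @measurable_ge0_set R.
have w_ge0 i : 0 <= P i - fill P x p i by rewrite subr_ge0 fill_le.
rewrite ge0_integral_sum//; last 2 first.
- move=> i; apply/measurable_EFinP/measurable_funM; first exact: measurable_cst.
  exact/measurable_funTS/measurable_indic.
- by move=> i u _; rewrite mule_ge0 ?lee_fin.
rewrite -sumEFin; apply: eq_bigr => i _.
rewrite ge0_integralZl_EFin//; last exact/measurable_EFinP/measurable_funTS/measurable_indic.
rewrite integral_indic// setIidl; last exact: itv_sub_ge0.
rewrite EFinM; congr (_ * _)%E.
rewrite /= lebesgue_measure_itv/= lte_fin.
by case: ltP => [_|x0]; rewrite ?oppr0 ?sube0 ?adde0//; congr EFin; apply/eqP; rewrite eq_le x_ge0.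
Qed.

Variables (Ebar : S -> R) (d : R -> R) (E0 : S -> R) (r : S -> R -> R).
Hypothesis policy_r : is_policy Ebar P d E0 r.
Hypothesis E0_ge0 : forall i, 0 <= E0 i.

Lemma policy_rate i : is_rate (r i) (P i).
Proof.
by case: policy_r => mr pr; split=> // t t_ge0; case: (pr t t_ge0) => _ [].
Qed.

Lemma energy0 i : energy E0 r i 0 = E0 i.
Proof. by rewrite /energy Rintegral_rate_point subr0. Qed.

Lemma energy_ge0 i t : 0 <= t -> 0 <= energy E0 r i t.
Proof. by move=> t_ge0; case: (policy_r.2 t t_ge0) => /(_ i)/andP[]. Qed.

Lemma energy_split i s t : 0 <= s -> s <= t ->
  energy E0 r i t = energy E0 r i s - Rintegral mu `[s, t] (r i).
Proof.
move=> s_ge0 st.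
by rewrite /energy (Rintegral_rate_split (policy_rate i) (lexx 0) s_ge0 st) opprD addrA.
Qed.

Lemma integral_policy_le i (T : \bar R) : (0 <= T)%E ->
  (\int[mu]_(t in upto T) (r i t)%:E <= (E0 i)%:E)%E.
Proof.
move=> T_ge0; apply: (integral_upto_le (policy_rate i)) => // t [t_ge0 _].
by rewrite -subr_ge0; exact: energy_ge0.
Qed.

Lemma measurable_policy_sum : measurable_fun [set t : R | 0 <= t] (fun t => \sum_i r i t).
Proof. by apply: measurable_sum => i; exact: (policy_rate i).1. Qed.

Hypothesis measurable_d : measurable_fun [set t : R | 0 <= t] d.

Lemma measurable_unserved (T : \bar R) :
  measurable_fun (upto T)
    (fun t => (Num.max (d t - \sum_i r i t) 0)%:E : \bar R).
Proof.
apply/measurable_EFinP; apply: (measurable_funS _ (@upto_sub_ge0 R T)).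
  exact: measurable_ge0_set.
apply: measurable_maxr; last exact: measurable_cst.
by apply: measurable_funB => //; exact: measurable_policy_sum.
Qed.

Lemma measurable_eD (T : \bar R) p :
  measurable_fun (upto T) (fun t => (Num.max 0 (d t - p))%:E : \bar R).
Proof.
apply/measurable_EFinP; apply: (measurable_funS _ (@upto_sub_ge0 R T)).
  exact: measurable_ge0_set.
apply: measurable_maxr; first exact: measurable_cst.
by apply: measurable_funB => //; exact: measurable_cst.
Qed.

(** A pointwise inequality is integrated, and no store can deliver more than its initial energy. The
    additive form avoids subtraction, as [eD] and [unserved] may both be infinite. *)
Lemma weak_duality (T : \bar R) p : (0 <= T)%E -> 0 <= p ->
  (eD d T p <= unserved d r T + eS P E0 p)%E.
Proof.
move=> T_ge0 p_ge0; rewrite eS_fill//; set x := duration E0.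
have mT := @measurable_upto R T.
pose w i := (P i - fill P x p i) / P i.
have w_ge0 i : 0 <= w i by rewrite divr_ge0 ?subr_ge0 ?fill_le// ltW.
have rate_w i := is_rate_mulr (w_ge0 i) (policy_rate i).
have m_w i : measurable_fun (upto T) (fun t => (r i t * w i)%:E).
  by apply/measurable_EFinP; exact: measurable_rate (rate_w i) mT (@upto_sub_ge0 R T).
have rw_ge0 i t : upto T t -> (0 <= (r i t * w i)%:E)%E.
  by move=> /upto_sub_ge0/(rate_w i).2/andP[]; rewrite lee_fin.
have sum_f : \sum_i fill P x p i <= p.
  by rewrite (@sum_fill _ _ _ P_gt0 _ _ xpredT)// ge_min lexx.
apply: (@le_trans _ _ (\int[mu]_(t in upto T)
    ((Num.max (d t - \sum_i r i t) 0)%:E + \sum_i (r i t * w i)%:E))%E).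
  apply: ge0_le_integral => //.
  - by move=> t _; rewrite lee_fin le_max lexx.
  - exact: measurable_eD.
  - by apply: emeasurable_funD; [exact: measurable_unserved|exact: emeasurable_sum].
  - move=> t Tt; have t_ge0 := upto_sub_ge0 Tt.
    rewrite sumEFin -EFinD lee_fin.
    have sum_w_ge0 : 0 <= \sum_i r i t * w i.
      by apply: sumr_ge0 => i _; rewrite -lee_fin rw_ge0.
    (* Each term is [fill P x p i] scaled by the fraction [r i t / P i], which is at most 1, and the
       [fill] shares add up to at most [p]. *)
    have : \sum_i (r i t - r i t * w i) <= p.
      apply: le_trans sum_f; apply: ler_sum => i _.
      have /andP[r_ge0 rP] := (policy_rate i).2 t t_ge0.
      have -> : r i t - r i t * w i = fill P x p i * (r i t / P i).
        by rewrite /w; field; rewrite gt_eqF.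
      by rewrite ler_piMr ?fill_ge0// ler_pdivrMr// mul1r.
    rewrite sumrB ge_max; case: (leP (d t - \sum_i r i t) 0) => *; apply/andP; split; lra.
rewrite ge0_integralD//; last 4 first.
- by move=> t _; rewrite lee_fin le_max lexx orbT.
- exact: measurable_unserved.
- by move=> t Tt; apply: sume_ge0 => i _; exact: rw_ge0.
- exact: emeasurable_sum.
rewrite leeD2l// ge0_integral_sum// -sumEFin; apply: lee_sum => i _.
apply: (integral_upto_le (rate_w i)) => // t [t_ge0 _].
rewrite (Rintegral_rate_mulr _ _ (policy_rate i))//.
rewrite /w mulrCA ler_wpM2l ?subr_ge0 ?fill_le// ler_wpM2r ?invr_ge0 ?(ltW (P_gt0 i))//.
by have := energy_ge0 i t_ge0; rewrite subr_ge0.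
Qed.

End Duality.

(** * Order preservation and attainment of the bound under GGDDF *)

Section Strong.
Variables (R : realType) (S : finType) (P : S -> R).
Hypothesis P_gt0 : forall i, 0 < P i.
Notation mu := (@lebesgue_measure R).
Variables (Ebar : S -> R) (d : R -> R) (E0 : S -> R) (r : S -> R -> R).
Hypothesis ggddf_r : ggddf Ebar P d E0 r.
Hypothesis E0_ge0 : forall i, 0 <= E0 i.

Let policy_r := ggddf_r.1.
Let x i t := energy E0 r i t / P i.

(** Full-power discharge lowers a duration at unit speed. *)
Lemma duration_decrease i s t : 0 <= s -> s <= t -> 0 <= x i s - x i t <= t - s.
Proof.
move=> s_ge0 st; rewrite /x (energy_split policy_r i s_ge0 st).
have -> : energy E0 r i s / P i -
    (energy E0 r i s - Rintegral mu `[s, t] (r i)) / P i =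
    Rintegral mu `[s, t] (r i) / P i by rewrite -mulrBl opprB addrC subrK.
rewrite divr_ge0 ?(ltW (P_gt0 i)) ?(Rintegral_rate_ge0 _ (policy_rate policy_r i))//=.
rewrite ler_pdivrMr// mulrC.
exact: Rintegral_rate_le (policy_rate policy_r i) s_ge0 st.
Qed.

(* Between the last time at which [x i <= x j] and [t], store [i] has the longer duration, hence discharges relatively faster than [j]. *)
Lemma duration_order_preserved i j s t : 0 <= s -> s <= t ->
  x i s <= x j s -> x i t <= x j t.
Proof.
move=> s_ge0 st ijs; rewrite leNgt; apply/negP => jit.
(* Time is reversed on [[s, t]], so the first zero of [g] corresponds to the last instant [a] at
   which the two durations agree. *)
pose g u := x i (s + t - u) - x j (s + t - u).
have [|||tau [/andP[s_tau tau_t] g_tau g_gt0]] :=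
  @first_exit _ g 1 s t _ ler01 st.
- move=> u v su uv vt; have su' : 0 <= s + t - v by lra.
  have uv' : s + t - v <= s + t - u by lra.
  have := duration_decrease i su' uv'; have := duration_decrease j su' uv'.
  by rewrite /g ler_norml => /andP[? ?] /andP[? ?]; apply/andP; split; lra.
- by rewrite /g addrAC subrr add0r subr_gt0.
- by rewrite /g addrK subr_le0.
pose a := s + t - tau.
have a_ge0 : 0 <= a by rewrite /a; lra.
have a_t : a <= t by rewrite /a; lra.
have inv_ge0 k : 0 <= (P k)^-1 by rewrite invr_ge0 ltW.
have : Rintegral mu `[a, t] (fun u => r j u * (P j)^-1) <=
       Rintegral mu `[a, t] (fun u => r i u * (P i)^-1).
  apply: (ae_le_Rintegral_rate (is_rate_mulr (inv_ge0 j) (policy_rate policy_r j))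
    (is_rate_mulr (inv_ge0 i) (policy_rate policy_r i)) a_ge0).
  have := ggddf_r.2; apply: (@filterS _ _ (ae_filter_ringOfSetsType mu)) => u gu au.
  have u_ge0 := itv_ge0 a_ge0 au.
  apply: (ggddf_at_ratio_le P_gt0 (gu u_ge0)).
  rewrite -subr_ge0 -/(x i u) -/(x j u).
  move: au; rewrite /= in_itv/= => /andP[au ut].
  have -> : x i u - x j u = g (s + t - u) by rewrite /g; congr (x i _ - x j _); lra.
  have [<-|ne] := eqVneq tau (s + t - u); first by rewrite g_tau.
  have lt_tau : s + t - u < tau by rewrite lt_neqAle eq_sym ne /=; move: au; rewrite /a; lra.
  by apply/ltW/g_gt0; rewrite lt_tau andbT; lra.
rewrite !(Rintegral_rate_mulr _ _ (policy_rate policy_r _) a_ge0).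
move: jit g_tau; rewrite /g -/a /x !(energy_split policy_r _ a_ge0 a_t) !mulrBl.
lra.
Qed.

Lemma strong_duality (T : \bar R) : (0 <= T)%E ->
  measurable_fun [set t : R | 0 <= t] d ->
  exists p, 0 <= p /\ unserved d r T = (eD d T p - eS P E0 p)%E.
Proof.
move=> T_ge0 measurable_d.
pose K i := `[< exists2 e : R, 0 < e & forall t, upto T t -> e <= energy E0 r i t >].
have K_gt0 i t : K i -> upto T t -> 0 < energy E0 r i t.
  by move=> /asboolP[e e_gt0 He] /He; exact: lt_le_trans.
(* After [t] the order is preserved, so [x j] stays above the bound for [x i]. Before [t], [x j] is
   at least its value at [t], which also exceeds that bound. *)
have K_up i j t : upto T t -> K i -> x i t <= x j t -> K j.
  move=> Tt /asboolP[e e_gt0 He] ij; apply/asboolP.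
  exists (e / P i * P j); first by rewrite mulr_gt0// divr_gt0.
  move=> u Tu; rewrite -ler_pdivlMr// -/(x j u).
  have le_iu v : upto T v -> e / P i <= x i v by move=> Tv; rewrite ler_pM2r ?invr_gt0// He.
  have [tu|/ltW ut] := leP t u.
    by apply: le_trans (le_iu _ Tu) _; apply: duration_order_preserved tu ij; case: Tt.
  have := duration_decrease j (Tu.1) ut; have := le_iu _ Tt; move: ij; lra.
(* The energy of a store outside [K] drops below every [e > 0], so the total drawn from it is within
   every [e] of [E0 i]. *)
have exhausted i : ~~ K i -> (\int[mu]_(t in upto T) (r i t)%:E = (E0 i)%:E)%E.
  move=> /asboolPn nK; apply/eqP; rewrite eq_le (integral_policy_le policy_r)//=.
  apply/lee_addgt0Pr => e e_gt0.
  have [t [Tt le]] : exists t, upto T t /\ energy E0 r i t < e.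
    apply: contrapT => none; apply: nK; exists e => // t Tt.
    by rewrite leNgt; apply/negP => lt; apply: none; exists t.
  apply: le_trans (leeD2r _ (integral_upto_ge (policy_rate policy_r i) Tt)).
  by move: le; rewrite /energy -EFinD lee_fin; lra.
pose p := \sum_(i | K i) P i.
have p_ge0 : 0 <= p by exact: sum_P_ge0.
exists p; split=> //.
(* [K] is up-closed with total power [p], so it fills the stack exactly up to height [p]: [fill]
   equals [P i] on [K] and 0 elsewhere. *)
have eS_p : eS P E0 p = (\sum_(i | ~~ K i) E0 i)%:E.
  rewrite eS_fill//; congr EFin; set x0 := fun i => E0 i / P i.
  have T0 : upto T 0 by split.
  have x0E i : x i 0 = x0 i by rewrite /x energy0.
  have sumK : \sum_(i | K i) (P i - fill P x0 p i) = 0.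
    rewrite sumrB sum_fill// ?minxx ?subrr// => i j Ki; rewrite -!x0E.
    exact: K_up.
  have fillK i : K i -> P i - fill P x0 p i = 0.
    move=> Ki; apply/eqP; rewrite eq_le subr_ge0 fill_le// andbT -sumK (bigD1 i)//= lerDl.
    by apply: sumr_ge0 => j _; rewrite subr_ge0 fill_le.
  have fillKC i : ~~ K i -> fill P x0 p i = 0.
    move=> Ki; apply/eqP; rewrite eq_le fill_ge0// andbT.
    have := @sum_fill _ _ _ P_gt0 x0 p xpredT p_ge0 (fun _ _ _ _ => isT).
    rewrite min_l; last by rewrite /p big_mkcond; apply: ler_sum => j _; case: ifP => // _; exact: ltW.
    rewrite (bigID K)/= sum_fill//; last by move=> j k Kj; rewrite -!x0E; exact: K_up.
    rewrite minxx => sum_all.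
    have sum0 : \sum_(i | ~~ K i) fill P x0 p i = 0.
      by apply: (addrI p); rewrite addr0; exact: sum_all.
    rewrite -sum0 (bigD1 i)//= lerDl; apply: sumr_ge0 => j _; exact: fill_ge0.
  rewrite (bigID K)/= big1 ?add0r => [|i Ki]; last by rewrite fillK ?mul0r.
  by apply: eq_bigr => i Ki; rewrite fillKC// subr0 /x0 mulrC divfK// gt_eqF.
have mT := @measurable_upto R T.
have m_r i : measurable_fun (upto T) (fun t => (r i t)%:E).
  apply/measurable_EFinP.
  exact: measurable_rate (policy_rate policy_r i) mT (@upto_sub_ge0 R T).
have r_ge0 i t : upto T t -> (0 <= (r i t)%:E)%E.
  by move=> /upto_sub_ge0/(policy_rate policy_r i).2/andP[]; rewrite lee_fin.
have eD_p : eD d T p = (unserved d r T + eS P E0 p)%E.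
  have -> : eS P E0 p = (\int[mu]_(t in upto T) \sum_(i | ~~ K i) (r i t)%:E)%E.
    under eq_integral do rewrite -big_filter.
    rewrite ge0_integral_sum// big_filter eS_p -sumEFin.
    by apply: eq_bigr => i /exhausted.
  rewrite -ge0_integralD//; last 4 first.
  - by move=> t _; rewrite lee_fin le_max lexx orbT.
  - exact: measurable_unserved policy_r measurable_d T.
  - by move=> t Tt; apply: sume_ge0 => i _; exact: r_ge0.
  - by under eq_fun do rewrite -big_filter; exact: emeasurable_sum.
  apply: ge0_ae_eq_integral => //.
  - exact: measurable_eD.
  - apply: emeasurable_funD; first exact: measurable_unserved policy_r measurable_d T.
    by under eq_fun do rewrite -big_filter; exact: emeasurable_sum.
  - by move=> t _; rewrite lee_fin le_max lexx.
  - move=> t Tt; rewrite adde_ge0 ?lee_fin ?le_max ?lexx ?orbT//.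
    by apply: sume_ge0 => i _; exact: r_ge0.
  have := ggddf_r.2; apply: (@filterS _ _ (ae_filter_ringOfSetsType mu)) => t gt Tt.
  have t_ge0 := upto_sub_ge0 Tt.
  have {gt} gt := gt t_ge0.
  have rP i : r i t <= P i by have /andP[] := (policy_rate policy_r i).2 t t_ge0.
  have rt_ge0 i : 0 <= r i t by rewrite -lee_fin r_ge0.
  have rC_ge0 : 0 <= \sum_(i | ~~ K i) r i t by exact: sumr_ge0.
  have rK_le : \sum_(i | K i) r i t <= p by apply: ler_sum.
  (* By [K_up] every store of [K] is strictly longer than a store outside [K], so it runs at full
     power as soon as one of the latter discharges. *)
  have K_first : 0 < \sum_(i | ~~ K i) r i t -> \sum_(i | K i) r i t = p.
    move=> sum_gt0; have [j /andP[Kj rj]|none] := pickP [pred j | ~~ K j & 0 < r j t].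
      apply: eq_bigr => i Ki; apply: (ggddf_at_priority P_gt0 gt _ rj).
      by rewrite ltNge; apply/negP => /(K_up _ _ _ Tt Ki); exact/negP.
    move: sum_gt0; rewrite big1 ?ltxx// => j Kj; apply/eqP.
    rewrite eq_le rt_ge0 andbT leNgt.
    by have := none j; rewrite /= Kj /= => ->.
  have := gt.1; rewrite (bigID K)/=.
  have p_le : p <= \sum_(i | 0 < energy E0 r i t) P i.
    rewrite /p big_mkcond [leRHS]big_mkcond; apply: ler_sum => i _.
    case: ifPn => [/K_gt0/(_ Tt)->//|_]; case: ifP => // _; exact: ltW.
  rewrite sumEFin -EFinD => sum_r; congr EFin.
  rewrite sum_r.
  move: sum_r rK_le rC_ge0 K_first p_le.
  set A := \sum_(i | K i) r i t; set B := \sum_(i | ~~ K i) r i t.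
  set N := \sum_(i | 0 < _) P i.
  (* If only [K] discharges, then [min (d t) N = A <= p <= N]: either [d t <= p] is fully served, or
     [N = p]. Otherwise [A = p], and demand above [p] splits into [B] and the unserved part. *)
  move=> sum_r A_p; rewrite le_eqVlt => /predU1P[B0 _|B_gt0 /(_ B_gt0) Ap].
    move: sum_r; rewrite -B0 !addr0.
    by case: (leP (d t) N) => dN AE pN; case: (leP 0 (d t - p)) => ?; case: leP; lra.
  move: sum_r; case: (leP (d t) N) => dN AE pN; case: (leP 0 (d t - p)) => ?; case: leP; lra.
by rewrite eD_p eS_p addeK.
Qed.

End Strong.

(** Taking a minimum is nonexpansive, so the smallest of finitely many Lipschitz gaps is again
    Lipschitz. *)
Lemma bigmin_dist (R : realFieldType) (I : finType) (Q : pred I) (f g : I -> R) (c e : R) :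
  0 <= e -> (forall k, `|f k - g k| <= e) ->
  `|\big[Num.min/c]_(k | Q k) f k - \big[Num.min/c]_(k | Q k) g k| <= e.
Proof.
move=> e_ge0 fg; elim/big_ind2: _ => [|a a' b b'|k _]; last exact: fg.
  by rewrite subrr normr0.
rewrite !ler_norml => /andP[? ?] /andP[? ?].
by case: (leP a b) => ?; case: (leP a' b') => ?; apply/andP; split; lra.
Qed.

(** * Construction of a GGDDF policy phase by phase *)

Section Existence.
Variables (R : realType) (S : finType) (P : S -> R).
Hypothesis P_gt0 : forall i, 0 < P i.
Notation mu := (@lebesgue_measure R).
Variable d : R -> R.
Hypothesis d_ge0 : forall t, 0 <= t -> 0 <= d t.
Hypothesis measurable_d : measurable_fun [set t : R | 0 <= t] d.

(* [None] stands for a phantom store of duration 0, so that emptying is a change of order like any other. *)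
Definition gap (E : S -> R) (k : S * option S) : R :=
  E k.1 / P k.1 - oapp (fun j => E j / P j) 0 k.2.

Definition order_rank (E : S -> R) : nat := #|[pred k | 0 < gap E k]|.

Definition frozen_rate (E : S -> R) (i : S) (t : R) : R :=
  if 0 < E i then fill P (fun j => E j / P j) (d t) i else 0.

Lemma frozen_rateP E i : is_rate (frozen_rate E i) (P i).
Proof.
split=> [|t _]; last first.
  by rewrite /frozen_rate; case: (0 < E i); rewrite ?fill_ge0 ?fill_le// lexx ltW.
rewrite /frozen_rate; case: (0 < E i); last exact: measurable_cst.
apply: measurable_funM; first exact: measurable_cst.
by apply: measurable_funB; apply: measurable_minr => //; exact: measurable_cst.
Qed.

Lemma frozen_rate_ratio_le E i j t : E j / P j <= E i / P i ->
  frozen_rate E j t / P j <= frozen_rate E i t / P i.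
Proof.
have gt0E k : (0 < E k) = (0 < E k / P k) by rewrite pmulr_lgt0 ?invr_gt0.
move=> ji; rewrite /frozen_rate; case: ifPn => [|_].
  by rewrite !gt0E => Ej; rewrite (lt_le_trans Ej ji); exact: fill_ratio_le.
by case: ifP => _; rewrite mul0r ?divr_ge0 ?fill_ge0 ?(ltW (P_gt0 i)).
Qed.

Section Phase.
Variables (s : R) (E : S -> R).
Hypotheses (s_ge0 : 0 <= s) (E_ge0 : forall i, 0 <= E i).

Let X i t := E i - Rintegral mu `[s, t] (frozen_rate E i).
Let rateE i := frozen_rateP E i.

Lemma phase_start i : X i s = E i.
Proof. by rewrite /X Rintegral_rate_point subr0. Qed.

Lemma phase_empty i t : E i <= 0 -> X i t = 0.
Proof.
move=> Ei; have E0 : E i = 0 by apply/eqP; rewrite eq_le Ei E_ge0.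
rewrite /X E0 (_ : frozen_rate E i = cst 0) ?Rintegral_cst ?mul0r ?subrr//.
by apply/funext => u; rewrite /frozen_rate E0 ltxx.
Qed.

(** Tied stores use equal fractions of their power at every instant, so ties never split within a
    phase. *)
Lemma phase_tied i j t : E i / P i = E j / P j -> X i t / P i = X j t / P j.
Proof.
move=> ij; rewrite /X !mulrBl ij -!(Rintegral_rate_mulr _ _ (rateE _) s_ge0).
congr (_ - _); apply: eq_Rintegral => u _; apply/eqP.
by rewrite eq_le !frozen_rate_ratio_le ?ij.
Qed.

Lemma phase_decrease i u v : s <= u -> u <= v ->
  0 <= X i u / P i - X i v / P i <= v - u.
Proof.
move=> su uv; have u_ge0 := le_trans s_ge0 su.
have -> : X i u / P i - X i v / P i = Rintegral mu `[u, v] (frozen_rate E i) / P i.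
  by rewrite -mulrBl /X (Rintegral_rate_split (rateE i) s_ge0 su uv); congr (_ / _); ring.
rewrite divr_ge0 ?(ltW (P_gt0 i)) ?(Rintegral_rate_ge0 _ (rateE i))//=.
by rewrite ler_pdivrMr// mulrC; exact: Rintegral_rate_le (rateE i) u_ge0 uv.
Qed.

(** The smallest of the gaps open at the start of the phase. The default 1 is positive, so a phase
    without open gaps never ends. *)
Let G t := \big[Num.min/1]_(k | 0 < gap E k) gap (X^~ t) k.

Lemma gap_lipschitz u v : s <= u -> u <= v -> `|G u - G v| <= 1 * (v - u).
Proof.
move=> su uv; rewrite mul1r; apply: bigmin_dist => [|[i o]]; first by rewrite subr_ge0.
rewrite /gap /=; have := phase_decrease i su uv.
case: o => [j|] /=; last by rewrite !subr0 => /andP[? ?]; rewrite ger0_norm.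
have := phase_decrease j su uv.
by rewrite ler_norml => /andP[? ?] /andP[? ?]; apply/andP; split; lra.
Qed.

(** Open gaps are still open and ties persist, so the durations are ordered as in [E], and [fill]
    depends on them only through their order. *)
Lemma phase_ggddf t : s <= t -> 0 < G t ->
  (forall i, 0 <= X i t) /\ ggddf_at P (X^~ t) (d t) (frozen_rate E ^~ t).
Proof.
move=> st /bigmin_gtP[_ gap_gt0].
have gt0E i : (0 < X i t) = (0 < E i).
  have [Ei|/phase_empty->] := ltP 0 (E i); last exact: ltxx.
  have := gap_gt0 (i, None); rewrite /gap /= !subr0 => /(_ (divr_gt0 Ei (P_gt0 i))).
  by rewrite pmulr_lgt0 ?invr_gt0.
have ltE i j : E i / P i < E j / P j -> X i t / P i < X j t / P j.
  by have := gap_gt0 (j, Some i); rewrite /gap /= !subr_gt0; apply.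
have cmpE i j : ((X i t / P i < X j t / P j) = (E i / P i < E j / P j)) *
    ((X j t / P j == X i t / P i) = (E j / P j == E i / P i)).
  have [/ltE lt|/ltE lt|/(phase_tied t)->] := ltgtP (E i / P i) (E j / P j).
  - by rewrite lt gt_eqF.
  - by rewrite ltNge ltW// lt_eqF.
  - by rewrite ltxx eqxx.
split=> [i|].
  by have [|/(phase_empty t)->//] := ltP 0 (E i); rewrite -gt0E; exact: ltW.
have -> : frozen_rate E ^~ t = (fun i => if 0 < X i t then
    fill P (fun j => X j t / P j) (d t) i else 0).
  apply/funext => i; rewrite /frozen_rate gt0E; case: ifP => // _.
  by apply: fill_eq => j; rewrite cmpE.
by apply: ggddf_at_fill => //; exact/d_ge0/(le_trans s_ge0).
Qed.

(** The phase ends at the first zero of [G]. There one open gap has closed, and none has been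
    reversed or newly opened, so the rank drops. *)
Lemma phase_end : (forall t, s <= t -> 0 < G t) \/
  exists tau, [/\ s <= tau, forall i, 0 <= X i tau,
    (order_rank (X^~ tau) < order_rank E)%N & forall t, s <= t < tau -> 0 < G t].
Proof.
have [|/existsNP[t1 /not_implyP[st1 /negP]]] := pselect (forall t, s <= t -> 0 < G t); first by left.
rewrite -leNgt => Gt1; right.
have [|||tau [/andP[s_tau _] G_tau G_gt0]] := @first_exit _ G 1 s t1 _ ler01 st1.
- by move=> u v su uv _; exact: gap_lipschitz.
- apply/bigmin_gtP; split=> // k; congr (0 < _).
  by rewrite /gap phase_start; case: k.2 => //= j; rewrite phase_start.
- exact: Gt1.
have gap_ge0 k : 0 < gap E k -> 0 <= gap (X^~ tau) k.
  by move=> Ek; rewrite -G_tau; exact: bigmin_le_cond.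
exists tau; split=> //.
  move=> i; have [Ei|/(phase_empty tau)->//] := ltP 0 (E i).
  have := gap_ge0 (i, None); rewrite /gap /= !subr0 => /(_ (divr_gt0 Ei (P_gt0 i))).
  by rewrite pmulr_lge0 ?invr_gt0.
(* Inclusion: a gap open at [tau] was open at the start. Properness: if every initial gap were still
   open, [G tau] would be positive. *)
apply: proper_card; apply/properP; split.
  apply/fintype.subsetP => -[i o]; rewrite !inE; apply: contraTT.
  rewrite -!leNgt /gap /=; case: o => [j|] /=; rewrite ?subr0.
    rewrite !subr_le0 le_eqVlt => /predU1P[/(phase_tied tau)->//|ij].
    by have := gap_ge0 (j, Some i); rewrite /gap /= subr_gt0 subr_ge0; apply.
  by rewrite pmulr_lle0 ?invr_gt0// => /(phase_empty tau)->; rewrite mul0r.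
apply: contrapT => all_gt0.
suff : 0 < G tau by rewrite G_tau ltxx.
apply/bigmin_gtP; split=> // k Ek; rewrite ltNge; apply/negP => gapk.
by apply: all_gt0; exists k; rewrite !inE// -leNgt.
Qed.

End Phase.

(** Induction on a strict bound for the rank: one phase is followed by a solution restarted from the
    configuration at its end. The rule then holds at every instant from [s] on. *)
Lemma exists_ggddf_from n s E : 0 <= s -> (forall i, 0 <= E i) ->
  (order_rank E < n)%N ->
  exists r : S -> R -> R, (forall i, is_rate (r i) (P i)) /\
    forall t, s <= t ->
      (forall i, 0 <= E i - Rintegral mu `[s, t] (r i)) /\
      ggddf_at P (fun i => E i - Rintegral mu `[s, t] (r i)) (d t) (r^~ t).
Proof.
elim: n s E => // n IHn s E s_ge0 E_ge0; rewrite ltnS => rankE.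
have [all_gt0|[tau [s_tau X_ge0 rank_lt G_gt0]]] := phase_end s_ge0 E_ge0.
  exists (frozen_rate E); split=> [i|t st]; first exact: frozen_rateP.
  exact: phase_ggddf (all_gt0 t st).
have tau_ge0 := le_trans s_ge0 s_tau.
have [r' [rate_r' ggddf_r']] := IHn tau _ tau_ge0 X_ge0 (leq_trans rank_lt rankE).
pose r i t := if t < tau then frozen_rate E i t else r' i t.
have rate_r i : is_rate (r i) (P i).
  split=> [|t t_ge0]; last first.
    by rewrite /r; case: (t < tau); [exact: (frozen_rateP E i).2|exact: (rate_r' i).2].
  apply: measurable_fun_if.
  - exact: measurable_ge0_set.
  - by apply: measurable_fun_ltr; [exact: measurable_id|exact: measurable_cst].
  - apply: measurable_funS (frozen_rateP E i).1; last exact: subIsetl.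
    exact: measurable_ge0_set.
  - apply: measurable_funS (rate_r' i).1; last exact: subIsetl.
    exact: measurable_ge0_set.
exists r; split=> // t st; have [t_tau|tau_t] := ltP t tau.
  have rE i : Rintegral mu `[s, t] (r i) = Rintegral mu `[s, t] (frozen_rate E i).
    apply: eq_Rintegral => u; rewrite inE/= in_itv/= => /andP[_ ut].
    by rewrite /r (le_lt_trans ut t_tau).
  have -> : r^~ t = frozen_rate E ^~ t by apply/funext => i; rewrite /r t_tau.
  under [X in ggddf_at _ X]eq_fun do rewrite rE.
  have st_tau : s <= t < tau by rewrite st.
  have [? ?] := phase_ggddf s_ge0 E_ge0 st (G_gt0 t st_tau).
  by split=> // i; rewrite rE.
have rE i : E i - Rintegral mu `[s, t] (r i) =
    E i - Rintegral mu `[s, tau] (frozen_rate E i) - Rintegral mu `[tau, t] (r' i).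
  rewrite (Rintegral_rate_split (rate_r i) s_ge0 s_tau tau_t) opprD addrA.
  congr (_ - _ - _).
    (* At [tau] itself the glued rate is already [r'], so the comparison is made on the half-open
       interval, whose missing endpoint is null. *)
    have itv_int f : is_rate f (P i) -> mu.-integrable `[s, tau[ (EFin \o f).
      move=> rf; apply: integrableS (integrable_rate tau rf s_ge0) => //.
      by apply: subset_itvl; rewrite bnd_simp.
    rewrite -Rintegral_itv_bndo_bndc; last exact/itv_int/rate_r.
    rewrite -Rintegral_itv_bndo_bndc; last exact/itv_int/frozen_rateP.
    by apply: eq_Rintegral => u; rewrite inE/= in_itv/= /r => /andP[_ ->].
  by apply: eq_Rintegral => u; rewrite inE/= in_itv/= /r => /andP[/le_gtF->].
have -> : r^~ t = r'^~ t by apply/funext => i; rewrite /r (le_gtF tau_t).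
under [X in ggddf_at _ X]eq_fun do rewrite rE.
have [? ?] := ggddf_r' t tau_t.
by split=> // i; rewrite rE.
Qed.

Lemma exists_ggddf (Ebar E0 : S -> R) : (forall i, 0 <= E0 i <= Ebar i) ->
  exists r, ggddf Ebar P d E0 r.
Proof.
move=> E0_bnd; have E0_ge0 i : 0 <= E0 i by case/andP: (E0_bnd i).
have [r [rate_r ggddf_r]] := exists_ggddf_from (lexx 0) E0_ge0 (ltnSn _).
exists r; split; last by apply: aeW => t /ggddf_r[].
split=> [i|t t_ge0]; first exact: (rate_r i).1.
have [E_ge0 [sum_r _]] := ggddf_r t t_ge0.
split=> [i|]; last by split=> [i|]; [exact: (rate_r i).2|rewrite sum_r ge_min lexx].
rewrite E_ge0/= (le_trans _ (proj2 (andP (E0_bnd i))))// gerBl.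
exact: Rintegral_rate_ge0 (rate_r i) (lexx 0).
Qed.

End Existence.

Lemma measurable_locally_integrable (R : realType) (d : R -> R) :
  (forall t, 0 <= t -> (@lebesgue_measure R).-integrable `[0, t] (EFin \o d)) ->
  measurable_fun [set t : R | 0 <= t] d.
Proof.
move=> int_d; rewrite ge0_setE itv_bndy_bigcup_BRight.
apply/measurable_fun_bigcup => // n; apply/measurable_EFinP.
by apply: measurable_int (int_d _ _); rewrite add0r.
Qed.

(** The maximum is expressed as a value attained at some [p0] together with a bound over all [p].
    The separate existence clause keeps the claim about every GGDDF policy from being vacuous. *)
Theorem theorem1 (R : realType) (S : finType) (Ebar P : S -> R)
  (d : R -> R) (E0 : S -> R) (T : \bar R) :
  (forall i, 0 < Ebar i) ->
  (forall i, 0 < P i) ->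
  (forall t, 0 <= t -> 0 <= d t) ->
  (forall t, 0 <= t -> (@lebesgue_measure R).-integrable `[0, t] (EFin \o d)) ->
  (forall i, 0 <= E0 i <= Ebar i) ->
  (0 < T)%E ->
  (exists r, ggddf Ebar P d E0 r) /\
  (forall r, ggddf Ebar P d E0 r ->
     (forall r', is_policy Ebar P d E0 r' ->
        (unserved d r T <= unserved d r' T)%E) /\
     (exists p0, 0 <= p0 /\ unserved d r T = (eD d T p0 - eS P E0 p0)%E) /\
     (forall p, 0 <= p -> (eD d T p - eS P E0 p <= unserved d r T)%E)).
Proof.
move=> _ P_gt0 d_ge0 int_d E0_bnd /ltW T_ge0.
have measurable_d := measurable_locally_integrable int_d.
have E0_ge0 i : 0 <= E0 i by case/andP: (E0_bnd i).
have weak r p : is_policy Ebar P d E0 r -> 0 <= p ->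
    (eD d T p - eS P E0 p <= unserved d r T)%E.
  move=> policy_r p_ge0.
  (* Moving [eS] across the inequality needs its finiteness, which [eS_fill] provides. *)
  rewrite leeBlDr; last by rewrite eS_fill.
  exact: (weak_duality P_gt0 policy_r E0_ge0 measurable_d T_ge0 p_ge0).
split; first exact: exists_ggddf.
move=> r ggddf_r.
have [p [p_ge0 unservedE]] := strong_duality P_gt0 ggddf_r E0_ge0 T_ge0 measurable_d.
(* The dual value attained by [r] at [p] bounds every policy from below, which is optimality. *)
split=> [r' policy_r'|]; first by rewrite unservedE; exact: weak.
by split=> [|q q_ge0]; [exists p|exact: weak ggddf_r.1 q_ge0].
Qed.
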